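(* For every knot or non-split link $K$, the corner connection tile number is less than the traditional tile number: $t_c(K) < t(K)$.
   Context: Knots and links are tame, in 3-space, up to ambient isotopy. A link is split if its components can be deformed so that some components lie on one side of a plane and the others on the other side. Each tile is a unit square. A connection point of a tile is an endpoint of a curve drawn on it. Traditional tiles (11 of them): connection points are midpoints of edges. $T_0$ is blank; four tiles ($T_1,\dots,T_4$) carry one arc joining the midpoints of two adjacent edges; two tiles ($T_5,T_6$) carry one segment joining the midpoints of two opposite edges; two tiles ($T_7,T_8$) carry two disjoint arcs each joining midpoints of adjacent edges; two tiles ($T_9,T_{10}$) carry the two segments joining midpoints of opposite edges, forming a crossing (two choices of over-strand). Corner connection tiles (11 of them): connection points are corners of the square. One tile is blank; four tiles carry one arc joining two adjacent corners; two tiles carry one diagonal; two tiles carry two disjoint arcs, each joining two adjacent corners, together using all four corners; two tiles carry both diagonals, forming a crossing (two choices of over-strand). A tile in an $n\times n$ array is suitably connected if each of its connection points touches a connection point of exactly one other tile of the array. An $n$-mosaic is an $n\times n$ array of tiles (all traditional, or all corner connection) in which every tile is suitably connected; it is a diagram of a knot or link. $t(K)$ (respectively $t_c(K)$) is the smallest number of non-blank tiles needed to construct $K$ on an $n$-mosaic of any size $n$ using traditional tiles (respectively corner connection tiles). *)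

(* Defs.v *)
From HB Require Import structures.
From mathcomp Require Import all_boot all_order all_algebra.
From mathcomp Require Import all_classical all_reals all_analysis.
Set Implicit Arguments.
Unset Strict Implicit.
Unset Printing Implicit Defensive.
Import Order.TTheory GRing.Theory Num.Theory.
Import numFieldNormedType.Exports.
Local Open Scope classical_set_scope.
Local Open Scope ring_scope.

Notation space3 R := (R * R * R)%type.

(** * Ambient isotopy *)

Definition homeomorphism (T U : topologicalType) (f : T -> U) : Prop :=
  exists g : U -> T, [/\ cancel f g, cancel g f, continuous f & continuous g].

Definition ambient_isotopy (R : realType) (H : R -> space3 R -> space3 R) : Prop :=
  [/\ {within `[0%R, 1%R] `*` [set: space3 R],
         continuous (fun p : R * space3 R => H p.1 p.2)},
      forall t : R, 0 <= t <= 1 -> homeomorphism (H t)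
    & forall x, H 0 x = x].

Definition ambient_isotopic (R : realType) (K K' : set (space3 R)) : Prop :=
  exists H : R -> space3 R -> space3 R, ambient_isotopy H /\ H 1 @` K = K'.

(** * Tame links *)

Definition segment (R : realType) (a b : space3 R) : set (space3 R) :=
  [set x | exists2 t : R, 0 <= t <= 1 & x = (1 - t) *: a + t *: b].

(* A closed polygon is given by its cyclic list of vertices. *)
Definition edge_ends (R : realType) (s : seq (space3 R)) (i : nat) :
  space3 R * space3 R := (s`_i, s`_(i.+1 %% size s)).

Definition edge (R : realType) (s : seq (space3 R)) (i : nat) : set (space3 R) :=
  segment (edge_ends s i).1 (edge_ends s i).2.

Definition polygon (R : realType) (s : seq (space3 R)) : set (space3 R) :=
  \bigcup_(i < size s) edge s i.

(* Distinct edges may only meet at common end points. *)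
Definition simple_polygon (R : realType) (s : seq (space3 R)) : Prop :=
  [/\ (2 < size s)%N, uniq s
    & forall i j, (i < size s)%N -> (j < size s)%N -> i != j ->
        edge s i `&` edge s j `<=`
          [set (edge_ends s i).1; (edge_ends s i).2] `&`
          [set (edge_ends s j).1; (edge_ends s j).2]].

(* A tame link is a set ambient isotopic to a polygonal link, that is, to a
   disjoint union of finitely many simple closed polygons.  Links are
   unoriented, and have [mu] components. *)
Definition tame_link_with (R : realType) (mu : nat) (K : set (space3 R)) : Prop :=
  exists s : nat -> seq (space3 R),
    [/\ forall i, (i < mu)%N -> simple_polygon (s i),
        trivIset `I_mu (fun i => polygon (s i))
      & ambient_isotopic (\bigcup_(i < mu) polygon (s i)) K].

Definition tame_link (R : realType) (K : set (space3 R)) : Prop :=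
  exists2 mu : nat, (0 < mu)%N & tame_link_with mu K.

Definition tame_knot (R : realType) (K : set (space3 R)) : Prop :=
  tame_link_with 1 K.

(* The two sides of the plane of equation [a.x = c]. *)
Definition dot (R : realType) (a x : space3 R) : R :=
  a.1.1 * x.1.1 + a.1.2 * x.1.2 + a.2 * x.2.

Definition lower_side (R : realType) (a : space3 R) (c : R) : set (space3 R) :=
  [set x | dot a x < c].

Definition upper_side (R : realType) (a : space3 R) (c : R) : set (space3 R) :=
  [set x | c < dot a x].

Definition split_link (R : realType) (K : set (space3 R)) : Prop :=
  exists (K' : set (space3 R)) (a : space3 R) (c : R),
    [/\ ambient_isotopic K K',
        a != 0,
        forall x, K' x -> connected_component K' x `<=` lower_side a c \/
                          connected_component K' x `<=` upper_side a c,
        exists2 x, K' x & connected_component K' x `<=` lower_side a c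
      & exists2 x, K' x & connected_component K' x `<=` upper_side a c].

(** * Tiles *)

Inductive tile_set := Traditional | Corner.

(* The four possible connection points of a tile are numbered cyclically by
   ['Z_4] (counterclockwise), starting from the midpoint of the bottom edge for
   traditional tiles and from the bottom left corner for corner connection
   tiles.  With this numbering both sets of 11 tiles have the same combinatorial
   description: [Arc k] joins [k] to [k + 1]; [Line b] joins [b] to [b + 2];
   [Arcs b] carries the arcs from [b] to [b + 1] and from [b + 2] to [b + 3];
   [Crossing b] carries the lines [0, 2] and [1, 3], and the former is the
   over-strand if and only if [b]. *)
Inductive tile :=
  | Blank
  | Arc of 'Z_4
  | Line of bool
  | Arcs of bool
  | Crossing of bool.

Definition blank (t : tile) : bool := if t is Blank then true else false.

(* The end points of the curves drawn on a tile; the boolean flags an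
   over-strand. *)
Definition strands (t : tile) : seq ('Z_4 * 'Z_4 * bool) :=
  match t with
  | Blank => [::]
  | Arc k => [:: (k, k + 1, false)]
  | Line b => [:: (b%:R, b%:R + 2%:R, false)]
  | Arcs b => [:: (b%:R, b%:R + 1, false); (b%:R + 2%:R, b%:R + 3%:R, false)]
  | Crossing b => [:: (0, 2%:R, b); (1, 3%:R, ~~ b)]
  end.

Definition connection_points (t : tile) : seq 'Z_4 :=
  flatten [seq [:: u.1.1; u.1.2] | u <- strands t].

(** * Mosaics *)

(* [M i j] is the tile on the unit square with bottom left corner [(i, j)].
   To keep them integral, the coordinates of connection points are in units of
   half a tile side. *)
Definition position (ts : tile_set) (i j : nat) (k : 'Z_4) : nat * nat :=
  let: (x, y) :=
    match ts with
    | Traditional => nth (0, 0)%N [:: (1, 0); (2, 1); (1, 2); (0, 1)]%N k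
    | Corner => nth (0, 0)%N [:: (0, 0); (2, 0); (2, 2); (0, 2)]%N k
    end in
  (i.*2 + x, j.*2 + y)%N.

Definition suitably_connected (ts : tile_set) (n : nat) (M : 'M[tile]_n)
    (i j : 'I_n) : Prop :=
  forall k, k \in connection_points (M i j) ->
    exists! ij' : 'I_n * 'I_n, ij' <> (i, j) /\
      exists2 k', k' \in connection_points (M ij'.1 ij'.2) &
        position ts ij'.1 ij'.2 k' = position ts i j k.

Definition is_mosaic (ts : tile_set) (n : nat) (M : 'M[tile]_n) : Prop :=
  forall i j, suitably_connected ts M i j.

Definition nonblank_tiles (n : nat) (M : 'M[tile]_n) : nat :=
  #|[pred ij : 'I_n * 'I_n | ~~ blank (M ij.1 ij.2)]|.

(* The point of the plane [z = 0] with coordinates [p] in half-units. *)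
Definition grid_point (R : realType) (p : nat * nat) : space3 R :=
  (p.1%:R / 2%:R, p.2%:R / 2%:R, 0).

(* The strand from [a] to [b] on tile [(i, j)] is drawn as a two-edge path.  Its
   middle vertex lies above the point halfway between the midpoint of [a, b] and
   the center of the tile: this is the center itself for lines, while arcs are
   bent towards the inside of the tile.  In particular, an arc joining adjacent
   corners only meets the boundary of its tile at these corners.  Only
   over-strands leave the plane [z = 0]; diagrams are viewed from above. *)
Definition strand_middle (R : realType) (ts : tile_set) (i j : nat)
    (u : 'Z_4 * 'Z_4 * bool) : space3 R :=
  4%:R^-1 *: (grid_point R (position ts i j u.1.1) +
              grid_point R (position ts i j u.1.2)) +
  2%:R^-1 *: grid_point R (i.*2.+1, j.*2.+1) +
  (0, 0, u.2%:R).

Definition strand_path (R : realType) (ts : tile_set) (i j : nat)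
    (u : 'Z_4 * 'Z_4 * bool) : set (space3 R) :=
  segment (grid_point R (position ts i j u.1.1)) (strand_middle R ts i j u) `|`
  segment (strand_middle R ts i j u) (grid_point R (position ts i j u.1.2)).

Definition mosaic_link (R : realType) (ts : tile_set) (n : nat)
    (M : 'M[tile]_n) : set (space3 R) :=
  [set x | exists (i j : 'I_n), exists2 u, u \in strands (M i j) &
     strand_path ts i j u x].

(** * Tile numbers *)

Definition constructs (R : realType) (ts : tile_set) (n : nat) (M : 'M[tile]_n)
    (K : set (space3 R)) : Prop :=
  is_mosaic ts M /\ ambient_isotopic (mosaic_link ts M) K.

(* [m] is the least number of non-blank tiles needed to construct [K]. *)
Definition tile_number (R : realType) (ts : tile_set) (K : set (space3 R))
    (m : nat) : Prop :=
  (exists (n : nat) (M : 'M[tile]_n), constructs ts M K /\ nonblank_tiles M = m)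
  /\ (forall (n : nat) (M : 'M[tile]_n),
        constructs ts M K -> (m <= nonblank_tiles M)%N).

(* Main.v *)
Require Import Defs.
From mathcomp Require Import all_boot all_order all_algebra.
From mathcomp Require Import all_classical all_reals all_analysis.
From mathcomp Require Import zify ring lra.
Set Implicit Arguments.
Unset Strict Implicit.
Unset Printing Implicit Defensive.
Import Order.TTheory GRing.Theory Num.Theory.
Import numFieldNormedType.Exports.
Local Open Scope classical_set_scope.
Local Open Scope ring_scope.

(** Every curve of a traditional tile lies in the diamond spanned by the
    midpoints of the edges of the tile.  Turned by 45 degrees and scaled, the
    diamond is a corner connection tile carrying the same curves.  A traditional
    mosaic therefore becomes a corner connection mosaic, in which every other
    tile, namely the turned diamond around a vertex of the original grid, is
    blank.  As the turn is isotopic to the identity ([unturn_isotopic]), this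
    already gives a corner tile number at most the traditional one.

    One tile is saved by using the blank diamonds.  Nothing enters the lowest
    non-blank row from below, so its leftmost non-blank tile is an arc from the
    right to the top; it is followed by horizontal lines up to an arc from the
    left to the top ([bottom_path]).  This piece of the link is called a cup; it
    goes through the tiles of columns [i0] to [i1] of row [j0].  The two ends of
    the cup are on the upper side of this row, and the straight segment
    between them goes through the diamonds around the [i1 - i0] vertices that
    lie between them.  Replacing the cup by the segment trades
    [i1 - i0 + 1] tiles for [i1 - i0] tiles ([corner_mosaic_count]).  The result
    is suitably connected ([diamond_mosaic]) since no other strand meets the
    segment: the inner tiles of the cup have no connection point at the top.

    The segment is moved back to the cup by an explicit isotopy.  The cup is the
    graph of [j0 + 1 - f] for a continuous function [f >= 0] ([dome]) that
    vanishes off the range of the cup ([cup_pathP]).  The picture of an arc is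
    symmetric enough for the rest of the link to stay on or above the graph of
    [j0 + 1 + f] wherever [f] is positive ([cup_push_fixed]).  Hence a vertical
    push, which slides the segment down by [f] and dies out at height
    [j0 + 1 + f], leaves the rest of the link where it is. *)

(** * Ambient isotopies *)

(** Composing the two isotopies at each time avoids concatenating them: at time
    1 the composite is the composite of the two final homeomorphisms. *)
Lemma ambient_isotopic_trans (R : realType) (K1 K2 K3 : set (space3 R)) :
  ambient_isotopic K1 K2 -> ambient_isotopic K2 K3 -> ambient_isotopic K1 K3.
Proof.
move=> [F [[Fc Fh F0] FK]] [G [[Gc Gh G0] GK]].
exists (fun s x => G s (F s x)); split; last first.
  by rewrite -GK -FK image_comp.
split=> [|s s01|x]; last by rewrite F0 G0.
- apply/subspace_continuousP => -[s x] sx01 /=.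
  move/subspace_continuousP: (Gc) => /(_ (s, F s x)) GsF.
  move/subspace_continuousP: (Fc) => /(_ _ sx01) Fsx.
  apply: (@cvg_comp _ _ _ (fun p : R * space3 R => (p.1, F p.1 p.2))
    (fun p => G p.1 p.2) _ _ _ _ (GsF _)); last by case: sx01.
  have FF : (fun p : R * space3 R => (p.1, F p.1 p.2)) @
      within (`[0%R, 1%R] `*` setT) (nbhs (s, x)) --> (s, F s x).
    apply: (@cvg_pair _ _ _ _ (nbhs s) (nbhs (F s x))) => //=.
    apply: cvg_trans; last exact: (@cvg_fst _ _ (nbhs s) (nbhs x)).
    by apply: cvg_app; exact: cvg_within.
  move=> A /= GA; have FA := FF _ GA.
  rewrite /nbhs /= /within /= in FA *.
  by apply: filterS FA => -[u v] /= uvA uv; apply: (uvA uv); case: uv.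
- have [f [Ff fF Fsc fc]] := Fh _ s01; have [g [Gg gG Gsc gc]] := Gh _ s01.
  exists (f \o g); split.
  + by move=> x /=; rewrite Gg Ff.
  + by move=> x /=; rewrite fF gG.
  + by move=> x; apply: continuous_comp; [exact: Fsc|exact: Gsc].
  + by move=> x; apply: continuous_comp; [exact: gc|exact: fc].
Qed.

Lemma continuous_pair (T U V : topologicalType) (f : T -> U) (g : T -> V) :
  continuous f -> continuous g -> continuous (fun x => (f x, g x)).
Proof.
by move=> fc gc x; apply: (@cvg_pair _ _ _ _ (nbhs (f x)) (nbhs (g x)));
  [exact: fc|exact: gc].
Qed.

(** For an isotopy given by formulas, the inverse of each stage is a formula
    too, and only needs to be continuous at a fixed time. *)
Lemma ambient_isotopic_by (R : realType) (H G : R -> space3 R -> space3 R)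
    (K : set (space3 R)) :
  continuous (fun p : R * space3 R => H p.1 p.2) ->
  (forall s, 0 <= s <= 1 ->
     [/\ cancel (H s) (G s), cancel (G s) (H s) & continuous (G s)]) ->
  (forall x, H 0 x = x) ->
  ambient_isotopic K (H 1 @` K).
Proof.
move=> Hc HG H0; exists H; split=> //; split=> // [|s s01].
  exact: continuous_subspaceT.
have [HK GK Gc] := HG s s01; exists (G s); split=> // x.
have := @continuous_comp _ _ _ (fun y => (s, y)) (fun p => H p.1 p.2) x.
apply; last exact: Hc.
by apply: continuous_pair => y; [exact: cst_continuous|exact: cvg_id].
Qed.

Lemma continuousD_fun (R : realType) (T : topologicalType) (f g : T -> R) :
  continuous f -> continuous g -> continuous (fun x => f x + g x).
Proof. by move=> fc gc x; apply: cvgD; [exact: fc|exact: gc]. Qed.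

Lemma continuousN_fun (R : realType) (T : topologicalType) (f : T -> R) :
  continuous f -> continuous (fun x => - f x).
Proof. by move=> fc x; apply: cvgN; exact: fc. Qed.

Lemma continuousM_fun (R : realType) (T : topologicalType) (f g : T -> R) :
  continuous f -> continuous g -> continuous (fun x => f x * g x).
Proof. by move=> fc gc x; apply: cvgM; [exact: fc|exact: gc]. Qed.

Lemma continuous_min_fun (R : realType) (T : topologicalType) (f g : T -> R) :
  continuous f -> continuous g -> continuous (fun x => Num.min (f x) (g x)).
Proof. by move=> fc gc x; apply: continuous_min; [exact: fc|exact: gc]. Qed.

Lemma continuous_max_fun (R : realType) (T : topologicalType) (f g : T -> R) :
  continuous f -> continuous g -> continuous (fun x => Num.max (f x) (g x)).
Proof. by move=> fc gc x; apply: continuous_max; [exact: fc|exact: gc]. Qed.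

Lemma continuous_fst_fun (T U V : topologicalType) (f : T -> U * V) :
  continuous f -> continuous (fun x => (f x).1).
Proof.
move=> fc x; apply: (cvg_comp f fst (fc x)).
exact: (@cvg_fst _ _ (nbhs (f x).1) (nbhs (f x).2)).
Qed.

Lemma continuous_snd_fun (T U V : topologicalType) (f : T -> U * V) :
  continuous f -> continuous (fun x => (f x).2).
Proof.
move=> fc x; apply: (cvg_comp f snd (fc x)).
exact: (@cvg_snd _ _ (nbhs (f x).1) (nbhs (f x).2)).
Qed.

Lemma continuous_comp_fun (T U V : topologicalType) (f : T -> U) (g : U -> V) :
  continuous f -> continuous g -> continuous (fun x => g (f x)).
Proof. by move=> fc gc x; apply: continuous_comp; [exact: fc|exact: gc]. Qed.

Ltac prove_continuous :=
  lazymatch goal with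
  | |- forall x, continuous_at x (fun y => y) => move=> ?; exact: cvg_id
  | |- forall x, continuous_at x (fun _ => ?c) => exact: cst_continuous
  | |- forall x, continuous_at x (fun y => (@?f y, @?g y)) =>
      apply: (@continuous_pair _ _ _ f g); prove_continuous
  | |- forall x, continuous_at x (fun y => @?f y + @?g y) =>
      apply: (@continuousD_fun _ _ f g); prove_continuous
  | |- forall x, continuous_at x (fun y => - @?f y) =>
      apply: (@continuousN_fun _ _ f); prove_continuous
  | |- forall x, continuous_at x (fun y => @?f y * @?g y) =>
      apply: (@continuousM_fun _ _ f g); prove_continuous
  | |- forall x, continuous_at x (fun y => Num.min (@?f y) (@?g y)) =>
      apply: (@continuous_min_fun _ _ f g); prove_continuous
  | |- forall x, continuous_at x (fun y => Num.max (@?f y) (@?g y)) =>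
      apply: (@continuous_max_fun _ _ f g); prove_continuous
  | |- forall x, continuous_at x (fun y => (@?f y).1) =>
      apply: (@continuous_fst_fun _ _ _ f); prove_continuous
  | |- forall x, continuous_at x (fun y => (@?f y).2) =>
      apply: (@continuous_snd_fun _ _ _ f); prove_continuous
  | gc : (forall x, continuous_at x ?g) |-
      forall x, continuous_at x (fun y => ?g (@?f y)) =>
      apply: (@continuous_comp_fun _ _ _ f g); [prove_continuous | exact: gc]
  end.

(** * Two explicit isotopies *)

Definition clamp (R : realType) (h y : R) : R := Num.max 0 (Num.min y h).

Lemma clampP (R : realType) (h y : R) : 0 <= h ->
  [\/ y <= 0 /\ clamp h y = 0, 0 <= y <= h /\ clamp h y = y
   | h <= y /\ clamp h y = h].
Proof.
move=> h0; rewrite /clamp; have [yh|hy] := leP y h.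
  have [y0|y0] := leP 0 y; last by constructor 1; rewrite ltW.
  by constructor 2.
by constructor 3; split; [exact: ltW | exact/max_idPr].
Qed.

(** On each vertical line, with [h = f x], every height up to [y0] is lowered by
    [h], and every height from [y0 + h] on is fixed. *)
Definition push_down (R : realType) (f : R -> R) (y0 : R) (p : space3 R) :
    space3 R :=
  (p.1.1, p.1.2 - clamp (f p.1.1) (y0 - p.1.2 + f p.1.1), p.2).

(** Stage [s] lowers points by [s] times as much.  On each vertical line it is
    increasing and piecewise linear with slopes 1 and [1 + s], whence the factor
    [1 + s] in its inverse. *)
Lemma push_down_isotopic (R : realType) (f : R -> R) (y0 : R)
    (K : set (space3 R)) :
  continuous f -> (forall x, 0 <= f x) ->
  ambient_isotopic K (push_down f y0 @` K).
Proof.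
move=> fc f_ge0.
pose H s (p : space3 R) : space3 R :=
  (p.1.1, p.1.2 - s * clamp (f p.1.1) (y0 - p.1.2 + f p.1.1), p.2).
pose G s (p : space3 R) : space3 R :=
  (p.1.1, p.1.2 + s * clamp (f p.1.1) ((y0 - p.1.2 + f p.1.1) / (1 + s)), p.2).
have -> : push_down f y0 = H 1.
  by apply/funext => p; rewrite /push_down /H mul1r.
apply: (ambient_isotopic_by (G := G)); last first.
- by case=> [[x y] z]; rewrite /H /= mul0r subr0.
- move=> s s01; have s1_gt0 : 0 < 1 + s by lra.
  have divE w : w / (1 + s) * (1 + s) = w by field; lra.
  split.
  + move=> [[x y] z]; rewrite /G /H /=; congr (_, _, _).
    have := f_ge0 x; move: (f x) => h h0.
    set w := y0 - y + h; set c := clamp h w.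
    set v := (y0 - (y - s * c) + h) / (1 + s).
    have vE : v * (1 + s) = w + s * c by rewrite divE /w; ring.
    suff -> : clamp h v = c by ring.
    rewrite /c in vE *.
    by case: (clampP w h0) vE => [[?]|[?]|[?]] -> vE;
      case: (clampP v h0) => [[?]|[?]|[?]] ->; nra.
  + move=> [[x y] z]; rewrite /G /H /=; congr (_, _, _).
    have := f_ge0 x; move: (f x) => h h0.
    set w := y0 - y + h.
    have vE := divE w; set v := w / (1 + s) in vE *; set c := clamp h v.
    have -> : y0 - (y + s * c) + h = w - s * c by rewrite /w; ring.
    suff -> : clamp h (w - s * c) = c by ring.
    set u := w - s * c; have uE : u = w - s * c by [].
    rewrite /c in uE *.
    by case: (clampP v h0) uE => [[?]|[?]|[?]] -> uE;
      case: (clampP u h0) => [[?]|[?]|[?]] ->; nra.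
  + by rewrite /G /clamp; prove_continuous.
- rewrite /H /clamp. prove_continuous.
Qed.

(** Inverse of the similarity (x, y) |-> (x + y - 1/2, y - x + c + 1/2), which
    maps the midpoints of the edges of the grid to integral points; a large [c]
    makes the coordinates of the image nonnegative. *)
Definition unturn (R : realType) (c : R) (p : space3 R) : space3 R :=
  ((p.1.1 - p.1.2 + c + 1) / 2%:R, (p.1.1 + p.1.2 - c) / 2%:R, p.2).

(** The segment from the identity to a rotation by 45 degrees times a scaling
    stays in the invertible matrices: at time [s] the determinant is
    ((2 - s)^2 + s^2) / 4. *)
Lemma unturn_isotopic (R : realType) (c : R) (K : set (space3 R)) :
  ambient_isotopic K (unturn c @` K).
Proof.
pose H s (p : space3 R) : space3 R :=
  ((1 - s / 2%:R) * p.1.1 - s / 2%:R * p.1.2 + s * (c + 1) / 2%:R,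
   s / 2%:R * p.1.1 + (1 - s / 2%:R) * p.1.2 - s * c / 2%:R, p.2).
pose d s : R := (2%:R - s) ^+ 2 + s ^+ 2.
pose G s (p : space3 R) : space3 R :=
  let x := p.1.1 - s * (c + 1) / 2%:R in
  let y := p.1.2 + s * c / 2%:R in
  (2%:R * ((2%:R - s) * x + s * y) / d s,
   2%:R * ((2%:R - s) * y - s * x) / d s, p.2).
have -> : unturn c = H 1.
  by apply/funext => p; rewrite /unturn /H; congr (_, _, _); field.
apply: (ambient_isotopic_by (G := G)); last first.
- by case=> [[x y] z]; rewrite /H /=; congr (_, _, _); field.
- move=> s _.
  have d_neq0 : d s != 0 by apply: lt0r_neq0; rewrite /d; nra.
  split.
  + by move=> [[x y] z]; rewrite /G /H /=; congr (_, _, _);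
      rewrite /d in d_neq0 *; field.
  + by move=> [[x y] z]; rewrite /G /H /=; congr (_, _, _);
      rewrite /d in d_neq0 *; field.
  + rewrite /G /=; prove_continuous.
- rewrite /H; prove_continuous.
Qed.

(** * The lowest row of a traditional mosaic *)

Lemma Z4_ind (P : 'Z_4 -> Prop) :
  P 0 -> P 1 -> P 2%:R -> P 3%:R -> forall k, P k.
Proof.
move=> P0 P1 P2 P3 [[|[|[|[|k]]]] k4] //.
- by rewrite (_ : Ordinal k4 = 0); [|exact: val_inj].
- by rewrite (_ : Ordinal k4 = 1); [|exact: val_inj].
- by rewrite (_ : Ordinal k4 = 2%:R); [|exact: val_inj].
- by rewrite (_ : Ordinal k4 = 3%:R); [|exact: val_inj].
Qed.

(** Position of the connection points of a diamond, in half-units, relative to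
    the lower left corner of the box bounding it. *)
Definition tip (k : 'Z_4) : nat * nat :=
  nth (0, 0)%N [:: (1, 0); (2, 1); (1, 2); (0, 1)]%N k.

(** Padding with blank tiles gives every tile its four neighbours, except on
    the left and bottom sides. *)
Definition tile_at (n : nat) (M : 'M[tile]_n) (i j : nat) : tile :=
  if insub i is Some i' then if insub j is Some j' then M i' j' else Blank
  else Blank.

Lemma tile_at_ord (n : nat) (M : 'M[tile]_n) (i j : 'I_n) :
  tile_at M i j = M i j.
Proof. by rewrite /tile_at !valK. Qed.

Variant tile_at_spec (n : nat) (M : 'M[tile]_n) (i j : nat) : tile -> Type :=
  | TileIn (i' j' : 'I_n) of i = i' :> nat & j = j' :> nat :
      tile_at_spec M i j (M i' j')
  | TileOut : tile_at_spec M i j Blank.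

Lemma tile_atP (n : nat) (M : 'M[tile]_n) (i j : nat) :
  tile_at_spec M i j (tile_at M i j).
Proof.
rewrite /tile_at; case: insubP => [i' _ <-|_]; last by constructor.
by case: insubP => [j' _ <-|_]; constructor.
Qed.

Local Notation uses T i j k := (k \in connection_points (T i j)).

(** The midpoint of an edge is on two tiles only, so that suitable connection
    amounts to an agreement of neighbours. *)
Definition connected_tiling (n : nat) (T : nat -> nat -> tile) : Prop :=
  [/\ forall i j, uses T i j 1 = uses T i.+1 j 3%:R,
      forall i j, uses T i j 2%:R = uses T i j.+1 0,
      forall j, ~~ uses T 0%N j 3%:R, 
      forall i, ~~ uses T i 0%N 0
    & forall i j, T i j <> Blank -> (i < n)%N && (j < n)%N].

Lemma traditional_neighbor (i j i' j' : nat) (k k' : 'Z_4) :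
  position Traditional i j k = position Traditional i' j' k' ->
  (i, j) <> (i', j') ->
  [\/ [&& k == 0, k' == 2%:R, i == i' & j == j'.+1],
      [&& k == 1, k' == 3%:R, i' == i.+1 & j == j'],
      [&& k == 2%:R, k' == 0, i == i' & j' == j.+1]
    | [&& k == 3%:R, k' == 1, i == i'.+1 & j == j']].
Proof.
have ne : (i, j) <> (i', j') -> ~ (i = i' /\ j = j').
  by move=> ij [ii jj]; apply: ij; rewrite ii jj.
move=> + /ne; elim/Z4_ind: k; elim/Z4_ind: k'; rewrite /position /= => -[??] ?;
  try lia; [constructor 1|constructor 2|constructor 3|constructor 4]; lia.
Qed.

Lemma mosaic_connected (n : nat) (M : 'M[tile]_n) :
  is_mosaic Traditional M -> connected_tiling n (tile_at M).
Proof.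
move=> Mm.
have nbr i j k : uses (tile_at M) i j k ->
    exists i' j' k', [/\ uses (tile_at M) i' j' k', (i, j) <> (i', j') &
      position Traditional i j k = position Traditional i' j' k'].
  case: tile_atP => // i0 j0 -> -> /Mm [[i' j'] /= [[ij [k' k'M kE]] _]].
  exists i', j', k'; rewrite tile_at_ord; split=> // -[ii jj].
  by apply: ij; congr (_, _); apply: val_inj.
split.
- move=> i j; apply/idP/idP => /nbr [i' [j' [k' [u ne e]]]].
    by case: (traditional_neighbor e ne) => // /and4P[_ /eqP ? /eqP ? /eqP ?];
      subst.
  by case: (traditional_neighbor e ne) => // /and4P[_ /eqP ? /eqP[?] /eqP ?];
    subst.
- move=> i j; apply/idP/idP => /nbr [i' [j' [k' [u ne e]]]].
    by case: (traditional_neighbor e ne) => // /and4P[_ /eqP ? /eqP ? /eqP ?];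
      subst.
  by case: (traditional_neighbor e ne) => // /and4P[_ /eqP ? /eqP ? /eqP[?]];
    subst.
- move=> j; apply/negP => /nbr [i' [j' [k' [u ne e]]]].
  by case: (traditional_neighbor e ne) => // /and4P[_ _ /eqP ? /eqP ?].
- move=> i; apply/negP => /nbr [i' [j' [k' [u ne e]]]].
  by case: (traditional_neighbor e ne) => // /and4P[_ _ /eqP ? /eqP ?].
- by move=> i j; case: tile_atP => // i' j' -> ->; rewrite !ltn_ord.
Qed.

Lemma tile_right_top (t : tile) : let u k := k \in connection_points t in
  ~~ u 0 -> ~~ u 3%:R -> t <> Blank -> t = Arc 1.
Proof.
by case: t => [|k|[]|[]|[]] //; elim/Z4_ind: k.
Qed.

Lemma tile_left (t : tile) : let u k := k \in connection_points t in
  ~~ u 0 -> u 3%:R -> t = Line true \/ t = Arc 2%:R.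
Proof.
by case: t => [|k|[]|[]|[]] //; [elim/Z4_ind: k|]; auto.
Qed.

Definition cup (T : nat -> nat -> tile) (i0 i1 j0 : nat) : Prop :=
  [/\ (i0 < i1)%N, T i0 j0 = Arc 1, T i1 j0 = Arc 2%:R,
    forall m, (i0 < m < i1)%N -> T m j0 = Line true
    & forall i j, (j < j0)%N -> T i j = Blank].

Lemma blankP (t : tile) : reflect (t <> Blank) (~~ blank t).
Proof. by case: t; constructor. Qed.

(** In the lowest non-blank row no tile is connected downwards.  Its first
    non-blank tile is not connected to the left either, hence is an arc to the
    right; the strand then has to go on to the right until it turns up. *)
Lemma bottom_path (n : nat) (T : nat -> nat -> tile) (i j : nat) :
  connected_tiling n T -> T i j <> Blank ->
  exists i0 i1 j0 : nat, cup T i0 i1 j0.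
Proof.
move=> [H V H0 V0 Tn] Tij.
have ex_row : exists j, [exists i : 'I_n, ~~ blank (T i j)].
  have /andP[i_n _] := Tn _ _ Tij.
  by exists j; apply/existsP; exists (Ordinal i_n); apply/blankP.
case: (ex_minnP ex_row) => j0 /existsP[i' Ti'] j0_min.
have below a b : (b < j0)%N -> T a b = Blank.
  move=> b_j0; apply: contrapT => Tab; have /andP[a_n _] := Tn _ _ Tab.
  have : (j0 <= b)%N.
    by apply: j0_min; apply/existsP; exists (Ordinal a_n); apply/blankP.
  by rewrite leqNgt b_j0.
have no0 a : ~~ uses T a j0 0.
  by case: (j0) below => [|b] // below; rewrite -V below.
have ex_col : exists a, ~~ blank (T a j0) by exists i'.
case: (ex_minnP ex_col) => i0 /blankP Ti0 i0_min.
have no3 : ~~ uses T i0 j0 3%:R.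
  case: (i0) i0_min => [|b] // i0_min; rewrite -H.
  case: (T b j0) (i0_min b) => //= [k|b'|b'|b'] /(_ isT); rewrite ltnn //.
have Ti0E : T i0 j0 = Arc 1 by apply: tile_right_top.
pose straight t := if t is Line true then true else false.
have ex_end : exists m, (i0 < m)%N && ~~ straight (T m j0).
  exists (n + i0.+1)%N; rewrite leq_addl /=.
  case E: (T _ j0) => //; have := Tn (n + i0.+1)%N j0; rewrite E.
  by move=> /(_ _)/andP[//|]; lia.
case: (ex_minnP ex_end) => i1 /andP[i01 Ti1] i1_min.
have middle m : (i0 < m < i1)%N -> T m j0 = Line true.
  move=> /andP[i0m mi1]; have : straight (T m j0).
    by apply: contraTT mi1 => Tm; rewrite -leqNgt i1_min // i0m.
  by case: (T m j0) => // -[].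
exists i0, i1, j0; split=> //.
have use3 : uses T i1 j0 3%:R.
  case: (i1) i01 middle => // b.
  rewrite ltnS leq_eqVlt => /orP[/eqP<- _|ib mid].
    by rewrite -H Ti0E.
  by rewrite -H mid // ib ltnSn.
by case: (tile_left (no0 i1) use3) => // Ti1E; rewrite Ti1E in Ti1.
Qed.

(** * Replacing the cup by a segment *)

Definition in_cup (i0 i1 j0 i j : nat) : bool := (j == j0) && (i0 <= i <= i1)%N.

(** The tiling by diamonds obtained by replacing the cup by a segment.  Diamonds
    are indexed by the lower left corner (a, b), in half-units, of the box
    bounding them: the tile (i, j) is the diamond (2i, 2j), and the vertex
    (m + 1, j + 1) is the center of the diamond (2m + 1, 2j + 1). *)
Definition diamond (T : nat -> nat -> tile) (i0 i1 j0 a b : nat) : tile :=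
  if odd a then
    if (b == j0.*2.+1) && (i0.*2 < a < i1.*2)%N then Line true else Blank
  else if odd b || in_cup i0 i1 j0 a./2 b./2 then Blank
  else T a./2 b./2.

Variant diamond_spec (T : nat -> nat -> tile) (i0 i1 j0 : nat) :
    nat -> nat -> tile -> Prop :=
  | DiamondLine m of (i0 <= m < i1)%N :
      diamond_spec T i0 i1 j0 m.*2.+1 j0.*2.+1 (Line true)
  | DiamondTile i j of ~~ in_cup i0 i1 j0 i j :
      diamond_spec T i0 i1 j0 i.*2 j.*2 (T i j)
  | DiamondBlank a b : diamond_spec T i0 i1 j0 a b Blank.

Lemma diamondP T i0 i1 j0 a b :
  diamond_spec T i0 i1 j0 a b (diamond T i0 i1 j0 a b).
Proof.
rewrite /diamond; case: ifP => a_odd.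
  case: ifP => [/andP[/eqP-> i0a]|_]; last by constructor.
  rewrite -[in X in diamond_spec _ _ _ _ X](odd_double_half a) a_odd add1n.
  by constructor; lia.
case: ifP => [_|/norP[b_odd ncup]]; first by constructor.
rewrite -[in X in diamond_spec _ _ _ _ X](odd_double_half a).
rewrite -[in X in diamond_spec _ _ _ _ _ X](odd_double_half b).
by rewrite a_odd (negbTE b_odd); constructor.
Qed.

Lemma diamond_line T i0 i1 j0 m : (i0 <= m < i1)%N ->
  diamond T i0 i1 j0 m.*2.+1 j0.*2.+1 = Line true.
Proof.
by move=> im; rewrite /diamond /= odd_double eqxx /= ifT //; lia.
Qed.

Lemma diamond_tile T i0 i1 j0 i j : ~~ in_cup i0 i1 j0 i j ->
  diamond T i0 i1 j0 i.*2 j.*2 = T i j.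
Proof.
by move=> ij; rewrite /diamond !odd_double !doubleK (negbTE ij).
Qed.

Lemma uses_diamond T i0 i1 j0 a b k : uses (diamond T i0 i1 j0) a b k ->
  (exists m, [/\ a = m.*2.+1, b = j0.*2.+1, (i0 <= m < i1)%N
     & (k == 1) || (k == 3%:R)]) \/
  (exists i j,
     [/\ a = i.*2, b = j.*2, ~~ in_cup i0 i1 j0 i j & uses T i j k]).
Proof.
case: diamondP => // [m im|i j ij] u; [left|right].
  by exists m; split=> //; elim/Z4_ind: k u.
by exists i, j.
Qed.

Definition same_tip (a b : nat) (k : 'Z_4) (a' b' : nat) (k' : 'Z_4) : Prop :=
  (a + (tip k).1 = a' + (tip k').1 /\ b + (tip k).2 = b' + (tip k').2)%N.

Lemma same_tip_position (i j : nat) (k : 'Z_4) (i' j' : nat) (k' : 'Z_4) :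
  same_tip i.*2 j.*2 k i'.*2 j'.*2 k' ->
  position Traditional i j k = position Traditional i' j' k'.
Proof.
have posE a b l : position Traditional a b l =
    (a.*2 + (tip l).1, b.*2 + (tip l).2)%N by elim/Z4_ind: l.
by rewrite !posE => -[-> ->].
Qed.

Definition diamond_connected (D : nat -> nat -> tile) : Prop :=
  forall a b k, uses D a b k -> exists a' b' k',
  [/\ uses D a' b' k', (a', b') <> (a, b), same_tip a b k a' b' k' &
   forall a'' b'' k'', uses D a'' b'' k'' -> (a'', b'') <> (a, b) ->
     same_tip a b k a'' b'' k'' -> a'' = a' /\ b'' = b'].

(** Around each midpoint of an edge the strands still match in pairs.  Among
    the edges touched by the change, those of the cup inside row [j0] lose both
    strands, the inner ones on the upper side of the row gain two since nothing
    was there, and at the two ends of the cup the segment replaces an arc. *)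
Lemma diamond_mosaic n T i0 i1 j0 : connected_tiling n T ->
  cup T i0 i1 j0 -> diamond_connected (diamond T i0 i1 j0).
Proof.
move=> [H V H0 V0 Tn] [i01 Ti0 Ti1 mid below] a b k.
have top m : (i0 <= m <= i1)%N -> uses T m j0.+1 0 -> m = i0 \/ m = i1.
  move=> im; rewrite -V; have [->|mi0] := eqVneq m i0; first by left.
  have [->|mi1] := eqVneq m i1; first by right.
  by rewrite mid //; lia.
have use_i0 : uses T i0 j0.+1 0 by rewrite -V Ti0.
have use_i1 : uses T i1 j0.+1 0 by rewrite -V Ti1.
have out m : ~~ in_cup i0 i1 j0 m j0.+1 by rewrite /in_cup; lia.
(* Uniqueness of the diamond meeting (c, d) at its tip [l] is checked separately
   for pieces of the segment and for tiles. *)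
have unique c d a' b' (l : 'Z_4) :
    (forall m' k', (i0 <= m' < i1)%N -> k' = 1 \/ k' = 3%:R ->
       ~ (m'.*2.+1 = c /\ j0.*2.+1 = d) ->
       same_tip c d l m'.*2.+1 j0.*2.+1 k' -> m'.*2.+1 = a' /\ j0.*2.+1 = b') ->
    (forall i' j' k', ~~ in_cup i0 i1 j0 i' j' -> uses T i' j' k' ->
       ~ (i'.*2 = c /\ j'.*2 = d) ->
       same_tip c d l i'.*2 j'.*2 k' -> i'.*2 = a' /\ j'.*2 = b') ->
    forall a'' b'' k'', uses (diamond T i0 i1 j0) a'' b'' k'' ->
     (a'', b'') <> (c, d) ->
     same_tip c d l a'' b'' k'' -> a'' = a' /\ b'' = b'.
  move=> onL onT a'' b'' k'' /uses_diamond used ne tips.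
  have {}ne : ~ (a'' = c /\ b'' = d) by case=> aE bE; apply: ne; rewrite aE bE.
  case: used ne tips => [[m [-> -> im km]]|[i [j [-> -> ij u]]]] ne tips.
    by apply: onL tips => //; case/orP: km => /eqP; auto.
  exact: onT tips.
have top' i j : uses T i j 0 -> j = j0.+1 -> (i0 <= i <= i1)%N ->
    i = i0 \/ i = i1.
  by move=> + jE im; rewrite jE; apply: top.
case/uses_diamond=> [[m [-> -> im /orP[/eqP->|/eqP->]]]|[i [j [-> -> ij u]]]].
(* On its right, a piece of the segment meets the next piece, or the tile above
   the right end of the cup. *)
- have [mi1|mi1] := eqVneq m.+1 i1.
    exists i1.*2, j0.+1.*2, 0; split.
    + by rewrite diamond_tile.
    + by case; lia.
    + by rewrite /same_tip /=; lia.
    + apply: unique => [m' k' im' [->|->]|i' j' k'];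
        rewrite /same_tip /=; try lia.
      by rewrite /in_cup; elim/Z4_ind: k' => /= *; lia.
  exists m.+1.*2.+1, j0.*2.+1, 3%:R; split.
  + by rewrite diamond_line //; lia.
  + by case; lia.
  + by rewrite /same_tip /=; lia.
  + apply: unique => [m' k' im' [->|->]|i' j' k'];
      rewrite /same_tip /=; try lia.
    rewrite /in_cup; elim/Z4_ind: k' => /= ? u *; try lia.
    by case: (top' _ _ u); lia.
(* On its left, it meets the previous piece, or the tile above the left end of
   the cup. *)
- have [mi0|mi0] := eqVneq m i0.
    exists i0.*2, j0.+1.*2, 0; split.
    + by rewrite diamond_tile.
    + by case; lia.
    + by rewrite /same_tip /=; lia.
    + apply: unique => [m' k' im' [->|->]|i' j' k'];
        rewrite /same_tip /=; try lia.
      by rewrite /in_cup; elim/Z4_ind: k' => /= *; lia.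
  exists m.-1.*2.+1, j0.*2.+1, 1; split.
  + by rewrite diamond_line //; lia.
  + by case; lia.
  + by rewrite /same_tip /=; lia.
  + apply: unique => [m' k' im' [->|->]|i' j' k'];
      rewrite /same_tip /=; try lia.
    rewrite /in_cup; elim/Z4_ind: k' => /= ? u *; try lia.
    by case: (top' _ _ u); lia.
(* By [top], a tile connected to the cup from above is above one of its ends,
   and now meets the first or the last piece of the segment.  All other tiles
   keep their neighbours. *)
- have [/andP[/eqP k0 /andP[/eqP jE i_in]]|inner] :=
    boolP ((k == 0) && in_cup i0 i1 j0.+1 i j).
    rewrite k0 jE in u *; case: (top _ i_in u) => iE.
      exists i0.*2.+1, j0.*2.+1, 3%:R; split.
      + by rewrite diamond_line //; lia.
      + by case; lia.
      + by rewrite /same_tip /=; lia.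
      + apply: unique => [m' k' im' [->|->]|i' j' k'];
          rewrite /same_tip /=; try lia.
        by rewrite /in_cup; elim/Z4_ind: k' => /= *; lia.
    exists i1.-1.*2.+1, j0.*2.+1, 1; split.
    + by rewrite diamond_line //; lia.
    + by case; lia.
    + by rewrite /same_tip /=; lia.
    + apply: unique => [m' k' im' [->|->]|i' j' k'];
        rewrite /same_tip /=; try lia.
      by rewrite /in_cup; elim/Z4_ind: k' => /= *; lia.
  have partner i' j' k' : ~~ in_cup i0 i1 j0 i' j' -> uses T i' j' k' ->
      (i, j) <> (i', j') -> same_tip i.*2 j.*2 k i'.*2 j'.*2 k' ->
      exists a' b' k', [/\ uses (diamond T i0 i1 j0) a' b' k',
         (a', b') <> (i.*2, j.*2), same_tip i.*2 j.*2 k a' b' k'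
       & forall a'' b'' k'', uses (diamond T i0 i1 j0) a'' b'' k'' ->
         (a'', b'') <> (i.*2, j.*2) -> same_tip i.*2 j.*2 k a'' b'' k'' ->
         a'' = a' /\ b'' = b'].
    move=> ij' u' ne tips; exists i'.*2, j'.*2, k'; rewrite diamond_tile //.
    split=> //.
      by case=> iE jE; apply: ne; congr (_, _); [clear - iE|clear - jE]; lia.
    apply: unique => [m'' k'' im'' k''E|i'' j'' k'' _ _].
      move: ij inner im''; rewrite /in_cup /same_tip; clear - k''E.
      by case: k''E => ->; elim/Z4_ind: (k) => /=; lia.
    move=> ne'' tips''.
    have {}ne'' : (i, j) <> (i'', j'').
      by case=> iE jE; apply: ne''; clear - iE jE; lia.
    move/same_tip_position in tips; move/same_tip_position in tips''.
    clear - tips ne tips'' ne''.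
    by case: (traditional_neighbor tips ne) => /and4P[/eqP k0 _ /eqP ? /eqP ?];
      case: (traditional_neighbor tips'' ne''); rewrite k0 //;
      move=> /and4P[_ _ /eqP ? /eqP ?]; lia.
  have noleft : ~~ uses T i0 j0 3%:R by rewrite Ti0.
  have noright : ~~ uses T i1 j0 1 by rewrite Ti1.
  move: u inner partner; elim/Z4_ind: (k) => u inner partner.
  - case: j ij u inner partner => [|j'] ij u inner partner.
      by rewrite (negbTE (V0 i)) in u.
    apply: (partner i j' 2%:R); last by rewrite /same_tip /=; clear; lia.
    + by move: inner; rewrite /in_cup /=; clear; lia.
    + by rewrite V.
    + by case; clear; lia.
  - apply: (partner i.+1 j 3%:R); last by rewrite /same_tip /=; clear; lia.
    + apply/negP => /andP[/eqP jE i_in]; have iE : i.+1 = i0.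
        by move: ij i_in; rewrite /in_cup; clear - jE; lia.
      by rewrite H jE iE (negbTE noleft) in u.
    + by rewrite -H.
    + by case; clear; lia.
  - apply: (partner i j.+1 0); last by rewrite /same_tip /=; clear; lia.
    + apply/negP => /andP[/eqP jE i_in].
      by rewrite below // -jE in u.
    + by rewrite -V.
    + by case; clear; lia.
  - case: i ij u inner partner => [|i'] ij u inner partner.
      by rewrite (negbTE (H0 j)) in u.
    apply: (partner i' j 1); last by rewrite /same_tip /=; clear; lia.
    + apply/negP => /andP[/eqP jE i_in]; have iE : i' = i1.
        by move: ij i_in; rewrite /in_cup; clear - jE; lia.
      by rewrite -H jE iE (negbTE noright) in u.
    + by rewrite H.
    + by case; clear; lia.
Qed.

(** * The corner connection mosaic *)

Definition corner_mosaic (n : nat) (D : nat -> nat -> tile) : 'M[tile]_n.*2 :=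
  \matrix_(p, q) if (q <= p + n)%N && (n <= p + q)%N
                 then D (p + n - q)%N (p + q - n)%N else Blank.

(** The turn maps the diamond (a, b) to the corner connection tile (p, q), that
    is, p = (a + b) / 2 and q = (b - a) / 2 + n. *)
Definition rotated (n a b p q : nat) : Prop :=
  (p + n = a + q /\ p + q = b + n)%N.

Definition even_support (n : nat) (D : nat -> nat -> tile) : Prop :=
  forall a b, D a b <> Blank ->
    [/\ odd a = odd b, (a.+1 < n.*2)%N & (b.+1 < n.*2)%N].

Lemma corner_mosaic_rotated n D a b (p q : 'I_n.*2) :
  rotated n a b p q -> corner_mosaic n D p q = D a b.
Proof.
move=> [pa qb]; rewrite mxE ifT; last by lia.
by congr D; lia.
Qed.

Lemma corner_mosaic_nonblank n D (p q : 'I_n.*2) :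
  corner_mosaic n D p q <> Blank -> exists a b, rotated n a b p q.
Proof.
rewrite mxE; case: ifP => // /andP[? ?] _.
by exists (p + n - q)%N, (p + q - n)%N; rewrite /rotated; lia.
Qed.

Lemma rotated_exists n D a b : even_support n D -> D a b <> Blank ->
  exists p q : 'I_n.*2, rotated n a b p q.
Proof.
move=> supp /supp [ab a_n b_n].
have abE := odd_double_half (a + b); rewrite oddD ab addbb add0n in abE.
have p_n : ((a + b)./2 < n.*2)%N by lia.
have q_n : ((a + b)./2 + n - a < n.*2)%N by lia.
by exists (Ordinal p_n), (Ordinal q_n); rewrite /rotated /=; lia.
Qed.

Lemma rotated_tip n a b p q k a' b' p' q' k' :
  rotated n a b p q -> rotated n a' b' p' q' ->
  same_tip a b k a' b' k' <-> position Corner p q k = position Corner p' q' k'.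
Proof.
move=> [pa qb] [pa' qb']; rewrite /same_tip.
have pairE (x y x' y' : nat) : x = x' -> y = y' -> (x, y) = (x', y').
  by move=> -> ->.
elim/Z4_ind: k; elim/Z4_ind: k'; rewrite /position /=;
  by (split=> -[? ?]; [apply: pairE|]; lia).
Qed.

Lemma used_nonblank (t : tile) (k : 'Z_4) :
  k \in connection_points t -> t <> Blank.
Proof. by case: t. Qed.

Lemma corner_mosaic_is_mosaic n D : even_support n D -> diamond_connected D ->
  is_mosaic Corner (corner_mosaic n D).
Proof.
move=> supp conn p q k u.
have [a [b ab]] := corner_mosaic_nonblank (used_nonblank u).
rewrite (corner_mosaic_rotated D ab) in u.
have [a' [b' [k' [u' ne tips uniq_ab]]]] := conn _ _ _ u.
have [p' [q' ab']] := rotated_exists supp (used_nonblank u').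
exists (p', q'); split=> /=.
  split; first by case=> pE qE; apply: ne; subst; move: ab ab';
    rewrite /rotated => *; congr (_, _); lia.
  exists k'; first by rewrite (corner_mosaic_rotated D ab').
  by apply/esym/(rotated_tip _ _ ab ab').
move=> [p'' q''] /= [ne'' [k'' u'' tips'']].
have [a'' [b'' ab'']] := corner_mosaic_nonblank (used_nonblank u'').
rewrite (corner_mosaic_rotated D ab'') in u''.
have [] := uniq_ab a'' b'' k'' u''.
- move=> [aE bE]; apply: ne''; move: ab ab''; rewrite /rotated => ? ?.
  by congr (_, _); apply: val_inj => /=; lia.
- exact/(rotated_tip _ _ ab ab'')/esym.
- move=> aE bE; move: ab' ab''; rewrite /rotated => ? ?.
  by congr (_, _); apply: val_inj => /=; lia.
Qed.

Lemma diamond_support n T i0 i1 j0 : connected_tiling n T -> cup T i0 i1 j0 ->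
  even_support n (diamond T i0 i1 j0).
Proof.
move=> [_ V _ _ Tn] [i01 Ti0 Ti1 _ _] a b.
have /andP[i1_n j0_n] : (i1 < n)%N && (j0.+1 < n)%N.
  by apply: Tn; apply: (@used_nonblank _ 0); rewrite -V Ti1.
case: diamondP => // [m im _|i j _ /Tn/andP[i_n j_n]].
  by rewrite /= !odd_double; split; lia.
by rewrite !odd_double; split; lia.
Qed.

(** Charge each piece of the segment, around the vertex (m + 1, j0 + 1), to the
    removed tile (m, j0), and every other tile to itself; nothing is charged to
    the last tile (i1, j0) of the cup.  Both charges send the diamond (a, b) to
    the tile (a / 2, b / 2). *)
Lemma corner_mosaic_count n (M : 'M[tile]_n) i0 i1 j0 :
  connected_tiling n (tile_at M) -> cup (tile_at M) i0 i1 j0 ->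
  (nonblank_tiles (corner_mosaic n (diamond (tile_at M) i0 i1 j0))
     < nonblank_tiles M)%N.
Proof.
set T := tile_at M; set D := diamond T i0 i1 j0 => conn cupT.
have [i01 Ti0 Ti1 mid _] := cupT; have [_ _ _ _ Tn] := conn.
have /andP[i1_n j0_n] : (i1 < n)%N && (j0 < n)%N by apply: Tn; rewrite Ti1.
pose e : 'I_n * 'I_n := (Ordinal i1_n, Ordinal j0_n).
pose o (x : nat) : 'I_n := insubd (Ordinal j0_n) x.
pose f (pq : 'I_n.*2 * 'I_n.*2) : 'I_n * 'I_n :=
  (o (pq.1 + n - pq.2)./2%N, o (pq.1 + pq.2 - n)./2%N).
rewrite /nonblank_tiles; set A := [pred _ | _]; set B := [pred _ | _].
have eB : e \in B by rewrite inE /= -tile_at_ord; apply/blankP; rewrite /= -/T Ti1.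
rewrite [X in (_ < X)%N](cardD1 e) eB add1n ltnS.
have fE (pq : 'I_n.*2 * 'I_n.*2) : pq \in A ->
    exists a b, [/\ rotated n a b pq.1 pq.2, D a b <> Blank,
      val (f pq).1 = a./2 & val (f pq).2 = b./2].
  case: pq => p q; rewrite inE /= => /blankP M0.
  have [a [b ab]] := corner_mosaic_nonblank M0.
  rewrite (corner_mosaic_rotated D ab) in M0.
  have [_ a_n b_n] := diamond_support conn cupT M0.
  exists a, b; move: (ab); rewrite /rotated => ?; split=> //=.
  - by rewrite /o val_insubd ifT; [congr (_./2)|]; lia.
  - by rewrite /o val_insubd ifT; [congr (_./2)|]; lia.
rewrite -(card_in_imset (f := f) (D := A)); last first.
  move=> [p q] [p' q'] /fE[a [b [ab D0 f1 f2]]] /fE[a' [b' [ab' D0' f1' f2']]] ff.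
  rewrite ff in f1 f2.
  have aE : a./2 = a'./2 by rewrite -f1 -f1'.
  have bE : b./2 = b'./2 by rewrite -f2 -f2'.
  suff [? ?] : a = a' /\ b = b'.
    move: ab ab'; rewrite /rotated /= => ? ?.
    by congr (_, _); apply: val_inj => /=; lia.
  move: D0 D0' aE bE; rewrite /D.
  case: diamondP => // [m mP|i j mP] _;
  by case: diamondP => // [m' mP'|i' j' mP'] _; move: mP mP'; rewrite /in_cup; lia.
apply: subset_leq_card.
apply/fintype.subsetP => ij /imsetP[pq /fE[a [b [ab D0 f1 f2]]] ->].
rewrite !inE; move: D0 f1 f2; case: (f pq) => /= i' j'; rewrite /D /T.
have eE : (i', j') == e -> i' = i1 :> nat /\ j' = j0 :> nat by case/eqP=> -> ->.
case: diamondP => // [m im|i j ij0] D0 i'E j'E; apply/andP; split.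
- by apply/negP => /eE; lia.
- rewrite -tile_at_ord i'E j'E (_ : j0.*2.+1./2 = j0); last by lia.
  apply/blankP; have [->|mi0] := eqVneq (m.*2.+1)./2 i0; first by rewrite -/T Ti0.
  by rewrite -/T mid //; lia.
- by apply/negP => /eE; move: ij0; rewrite /in_cup; lia.
- by rewrite -tile_at_ord i'E j'E !doubleK; apply/blankP.
Qed.

(** * Strands in a diamond *)

Lemma scale3E (R : realType) (t x y z : R) :
  t *: ((x, y, z) : space3 R) = (t * x, t * y, t * z).
Proof. by []. Qed.

Lemma add3E (R : realType) (x y z x' y' z' : R) :
  (x, y, z) + (x', y', z') = (x + x', y + y', z + z') :> space3 R.
Proof. by []. Qed.

(** The path that draws a strand, in terms of the center [c] of the tile and the
    height [z] of the strand.  Its middle vertex is an affine combination of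
    [a], [b] and [c], so that affine maps preserve bent paths. *)
Definition bent (R : realType) (a c b : space3 R) (z : R) : set (space3 R) :=
  let m := 4%:R^-1 *: (a + b) + 2%:R^-1 *: c + (0, 0, z) in
  segment a m `|` segment m b.

Definition barycentric (R : realType) (f : space3 R -> space3 R) : Prop :=
  forall t a b, f ((1 - t) *: a + t *: b) = (1 - t) *: f a + t *: f b.

Lemma image_segment (R : realType) (f : space3 R -> space3 R) a b :
  barycentric f -> f @` segment a b = segment (f a) (f b).
Proof.
move=> f_bar; apply/seteqP; split=> [_ [_ [t t01 ->] <-]|_ [t t01 ->]].
  by exists t.
by exists ((1 - t) *: a + t *: b) => //; exists t.
Qed.

Lemma image_bent (R : realType) (f : space3 R -> space3 R) a c b z :
  barycentric f -> (forall v, f (v + (0, 0, z)) = f v + (0, 0, z)) ->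
  f @` bent a c b z = bent (f a) (f c) (f b) z.
Proof.
move=> f_bar fz; rewrite /bent image_setU !image_segment // fz.
suff -> : f (4%:R^-1 *: (a + b) + 2%:R^-1 *: c) =
  4%:R^-1 *: (f a + f b) + 2%:R^-1 *: f c by [].
have halves x y : f (2%:R^-1 *: x + 2%:R^-1 *: y) =
    2%:R^-1 *: f x + 2%:R^-1 *: f y.
  have e : 2%:R^-1 = 1 - 2%:R^-1 :> R by field.
  by rewrite [X in X *: x]e f_bar -e.
have quarter (v : space3 R) : 4%:R^-1 *: v = 2%:R^-1 *: (2%:R^-1 *: v).
  by rewrite scalerA -invfM -natrM.
by rewrite !quarter !(scalerDr 2%:R^-1 a) !halves -!scalerDr.
Qed.

Definition diamond_path (R : realType) (a b : nat) (u : 'Z_4 * 'Z_4 * bool) :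
    set (space3 R) :=
  bent (grid_point R (a + (tip u.1.1).1, b + (tip u.1.1).2)%N)
       (grid_point R (a.+1, b.+1))
       (grid_point R (a + (tip u.1.2).1, b + (tip u.1.2).2)%N) u.2%:R.

Definition diamond_link (R : realType) (D : nat -> nat -> tile) :
    set (space3 R) :=
  [set x | exists a b, exists2 u, u \in strands (D a b) & diamond_path a b u x].

Lemma strand_path_traditional (R : realType) i j u :
  @strand_path R Traditional i j u = @diamond_path R i.*2 j.*2 u.
Proof.
have posE k : position Traditional i j k = (i.*2 + (tip k).1, j.*2 + (tip k).2)%N.
  by elim/Z4_ind: k.
by rewrite /strand_path /strand_middle /diamond_path /bent !posE.
Qed.

(** The numbering of connection points makes the turn map each strand of a
    diamond to the strand of the corner connection tile with the same name. *)
Lemma unturn_strand_path (R : realType) n a b p q u : rotated n a b p q ->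
  unturn n%:R @` @strand_path R Corner p q u = @diamond_path R a b u.
Proof.
move=> [pa qb].
have {}pa : p%:R + n%:R = a%:R + q%:R :> R by rewrite -!natrD pa.
have {}qb : p%:R + q%:R = b%:R + n%:R :> R by rewrite -!natrD qb.
have -> : @strand_path R Corner p q u =
    bent (grid_point R (position Corner p q u.1.1))
      (grid_point R (p.*2.+1, q.*2.+1))
      (grid_point R (position Corner p q u.1.2)) u.2%:R by [].
rewrite image_bent.
- congr bent.
  + by elim/Z4_ind: u.1.1; rewrite /grid_point /unturn /position /tip /= !natrD
      -!muln2 !natrM; congr (_, _, _); lra.
  + rewrite /grid_point /unturn /= -[p.*2.+1%:R]natr1 -[q.*2.+1%:R]natr1 -[a.+1%:R]natr1.
    by rewrite -[b.+1%:R]natr1 -!muln2 !natrM; congr (_, _, _); lra.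
  + by elim/Z4_ind: u.1.2; rewrite /grid_point /unturn /position /tip /= !natrD
      -!muln2 !natrM; congr (_, _, _); lra.
- by move=> t [[x y] z] [[x' y'] z']; rewrite !scale3E !add3E /unturn /=;
  congr (_, _, _); field.
- by move=> [[x y] z]; rewrite !add3E /unturn /= !addr0.
Qed.

Lemma unturn_corner_link (R : realType) n D : even_support n D ->
  unturn n%:R @` mosaic_link (R := R) Corner (corner_mosaic n D) =
  diamond_link (R := R) D.
Proof.
move=> supp; apply/seteqP; split=> [_ [x [p [q [u u_pq xu]]] <-]|].
  have [|a [b ab]] := @corner_mosaic_nonblank n D p q.
    by move=> M0; rewrite M0 in u_pq.
  exists a, b, u; first by rewrite (corner_mosaic_rotated D ab) in u_pq.
  by rewrite -(unturn_strand_path _ _ ab); exists x.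
move=> x [a [b [u u_ab xu]]].
have [|p [q pq]] := rotated_exists supp (a := a) (b := b).
  by move=> D0; rewrite D0 in u_ab.
move: xu; rewrite -(unturn_strand_path _ _ pq) => -[y yu <-].
by exists y => //; exists p, q, u => //; rewrite (corner_mosaic_rotated D pq).
Qed.

Lemma diamond_path_shift (R : realType) a b u :
  @diamond_path R a b u =
  (fun v => v + (a%:R / 2%:R, b%:R / 2%:R, 0)) @` @diamond_path R 0 0 u.
Proof.
rewrite [in RHS]/diamond_path image_bent.
- have shiftE i j : grid_point R (a + i, b + j)%N =
      grid_point R (0 + i, 0 + j)%N + (a%:R / 2%:R, b%:R / 2%:R, 0).
    by rewrite /grid_point !add3E /= !natrD; congr (_, _, _); lra.
  by rewrite -!shiftE /diamond_path -[a.+1]addn1 -[b.+1]addn1 shiftE.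
- move=> t [[x y] z] [[x' y'] z'].
  by rewrite !scale3E !add3E /=; congr (_, _, _); ring.
- by move=> v; rewrite addrAC.
Qed.

Lemma unit_pathP (R : realType) (k l : 'Z_4) (o : bool) (x y z : R) :
  let tx m : R := (tip m).1%:R / 2%:R in let ty m : R := (tip m).2%:R / 2%:R in
  let mx := (tx k + tx l) / 4%:R + 4%:R^-1 in
  let my := (ty k + ty l) / 4%:R + 4%:R^-1 in
  diamond_path 0 0 (k, l, o) (x, y, z) <->
  exists2 t : R, 0 <= t <= 1 &
    [/\ x = (1 - t) * tx k + t * mx, y = (1 - t) * ty k + t * my & z = t * o%:R] \/
    [/\ x = (1 - t) * mx + t * tx l, y = (1 - t) * my + t * ty l
      & z = (1 - t) * o%:R].
Proof.
move=> tx ty mx my; rewrite /diamond_path /bent.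
set m := _ + (0, 0, _).
have -> : m = (mx, my, o%:R).
  rewrite /m /grid_point !add3E !scale3E /mx /my /tx /ty /= !add0n.
  by congr (_, _, _); field.
rewrite /grid_point /= !add0n /segment; split.
  case=> -[t t01]; rewrite !scale3E !add3E => -[-> -> ->]; exists t => //.
    by left; split=> //; ring.
  by right; split=> //; ring.
case=> t t01 [] [-> -> ->]; [left|right]; exists t => //;
  by rewrite !scale3E !add3E; congr (_, _, _); ring.
Qed.

(** * The profile of an arc *)

(** Height of an arc above the connection point where it starts, at horizontal
    distance [w] from that point.  The break at 1/8 is the middle vertex. *)
Definition bend (R : realType) (w : R) : R :=
  Num.min (3%:R * w) ((1 + w) / 3%:R).

Lemma bendP (R : realType) (w : R) :
  (w <= 8%:R^-1 /\ bend w = 3%:R * w) \/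
  (8%:R^-1 <= w /\ bend w = (1 + w) / 3%:R).
Proof.
by rewrite /bend; have [?|?] := leP (3%:R * w) ((1 + w) / 3%:R);
  [left|right]; split=> //; lra.
Qed.

Lemma arc12P (R : realType) (x y z : R) :
  diamond_path 0 0 (1, 2%:R, false) (x, y, z) <->
  [/\ 2%:R^-1 <= x <= 1, y = 1 - bend (x - 2%:R^-1) & z = 0].
Proof.
rewrite unit_pathP /=; split.
  by case=> t t01 [[xE yE zE]|[xE yE zE]]; case: (bendP (x - 2%:R^-1)) => -[? ->];
    split; lra.
case=> x12 -> ->; case: (bendP (x - 2%:R^-1)) => -[? ->].
  by exists (1 - 8%:R * (x - 2%:R^-1)); [lra|right; split; lra].
by exists ((1 - x) * (8%:R / 3%:R)); [lra|left; split; lra].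
Qed.

Lemma arc23P (R : realType) (x y z : R) :
  diamond_path 0 0 (2%:R, 3%:R, false) (x, y, z) <->
  [/\ 0 <= x <= 2%:R^-1, y = 1 - bend (2%:R^-1 - x) & z = 0].
Proof.
rewrite unit_pathP /=; split.
  by case=> t t01 [[xE yE zE]|[xE yE zE]]; case: (bendP (2%:R^-1 - x)) => -[? ->];
    split; lra.
case=> x12 -> ->; case: (bendP (2%:R^-1 - x)) => -[? ->].
  by exists (8%:R * (2%:R^-1 - x)); [lra|left; split; lra].
by exists (1 - x * (8%:R / 3%:R)); [lra|right; split; lra].
Qed.

Lemma line13P (R : realType) (x y z : R) :
  diamond_path 0 0 (1, 3%:R, false) (x, y, z) <->
  [/\ 0 <= x <= 1, y = 2%:R^-1 & z = 0].
Proof.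
rewrite unit_pathP /=; split.
  by case=> t t01 [[xE yE zE]|[xE yE zE]]; split; lra.
case=> x12 -> ->; have [x2|x2] := leP x 2%:R^-1.
  by exists (1 - 2%:R * x); [lra|right; split; lra].
by exists (2%:R * (1 - x)); [lra|left; split; lra].
Qed.

Lemma bend_min (R : realType) (w : R) :
  bend w <= 3%:R * w /\ bend w <= (1 + w) / 3%:R.
Proof. by case: (bendP w) => -[? ->]; split; lra. Qed.

Lemma bend_le (R : realType) (w : R) : w <= 2%:R^-1 -> bend w <= 2%:R^-1.
Proof. by move=> ?; case: (bendP w) => -[? ->]; lra. Qed.

Lemma bend_ge0 (R : realType) (w : R) : 0 <= w -> 0 <= bend w.
Proof. by move=> ?; case: (bendP w) => -[? ->]; lra. Qed.

Lemma bend_ge (R : realType) (w : R) : 2%:R^-1 <= w -> 2%:R^-1 <= bend w.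
Proof. by move=> ?; case: (bendP w) => -[? ->]; lra. Qed.

Lemma bend_le0 (R : realType) (w : R) : w <= 0 -> bend w <= 0.
Proof. by move=> ?; case: (bendP w) => -[? ->]; lra. Qed.

Lemma strand_box (R : realType) (k l : 'Z_4) (o : bool) (x y z : R) :
  diamond_path 0 0 (k, l, o) (x, y, z) -> 0 <= x <= 1 /\ 0 <= y.
Proof.
rewrite unit_pathP; elim/Z4_ind: k; elim/Z4_ind: l => /=;
  by case=> t t01 [[-> -> _]|[-> -> _]]; split; nra.
Qed.

(** An arc at the bottom of a tile is the mirror image of one at the top of the
    tile below, so no strand comes between the bottom of its tile and these
    mirror images. *)
Lemma strand_above (R : realType) (t : tile) u (x y z : R) :
  u \in strands t -> diamond_path 0 0 u (x, y, z) ->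
  [/\ 0 <= x <= 1, 0 <= y,
     0 \notin connection_points t -> 2%:R^-1 <= y,
     2%:R^-1 <= x -> bend (x - 2%:R^-1) <= y
   & x <= 2%:R^-1 -> bend (2%:R^-1 - x) <= y].
Proof.
move=> ut xu; have [x01 y0] : 0 <= x <= 1 /\ 0 <= y.
  by case: u xu {ut} => [[k l] o]; exact: strand_box.
have above : 2%:R^-1 <= y \/ 0 \in connection_points t /\
    (2%:R^-1 <= x -> bend (x - 2%:R^-1) <= y) /\
    (x <= 2%:R^-1 -> bend (2%:R^-1 - x) <= y).
  have [bx1 bx2] := bend_min (x - 2%:R^-1).
  have [bx3 bx4] := bend_min (2%:R^-1 - x).
  move: ut xu; case: t => [|k|[]|[]|[]] //=; try (elim/Z4_ind: k);
    rewrite !inE => ut; move: ut; try (case/orP=> /eqP->); try (move/eqP->);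
    rewrite unit_pathP /= => -[t t01 [[xE yE _]|[xE yE _]]];
    by first [left; lra | right; split; [by [] | split=> ?; lra]].
case: above => [y2|[c [b1 b2]]]; split=> //.
- by move=> x2; apply: le_trans (bend_le _) y2; lra.
- by move=> x2; apply: le_trans (bend_le _) y2; lra.
- by rewrite c.
Qed.

(** Depth of the cup below its end points, at [a] and [b]: it starts like an arc
    on both sides, and is 1/2 along the horizontal lines. *)
Definition dome (R : realType) (a b x : R) : R :=
  Num.max 0 (Num.min 2%:R^-1 (Num.min (bend (x - a)) (bend (b - x)))).

Lemma dome_continuous (R : realType) (a b : R) : continuous (dome a b).
Proof. by rewrite /dome /bend; prove_continuous. Qed.

Lemma dome_ge0 (R : realType) (a b x : R) : 0 <= dome a b x.
Proof. by rewrite /dome le_max lexx. Qed.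

Lemma dome_le (R : realType) (a b x : R) : dome a b x <= 2%:R^-1.
Proof. by rewrite /dome ge_max ge_min lexx andbT; lra. Qed.

Lemma dome_out (R : realType) (a b x : R) : x <= a \/ b <= x -> dome a b x = 0.
Proof.
move=> xab; apply/max_idPl; rewrite 2!ge_min.
by apply/orP; right; apply/orP; case: xab => ?; [left|right];
  apply: bend_le0; lra.
Qed.

Lemma dome_left (R : realType) (a b x : R) :
  a + 1 <= b -> a <= x <= a + 2%:R^-1 -> dome a b x = bend (x - a).
Proof.
move=> ab xa; have ? : 0 <= bend (x - a) by apply: bend_ge0; lra.
have ? : bend (x - a) <= 2%:R^-1 by apply: bend_le; lra.
have ? : 2%:R^-1 <= bend (b - x) by apply: bend_ge; lra.
rewrite /dome (min_idPl (_ : bend (x - a) <= bend (b - x))); last by lra.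
by rewrite (min_idPr _) // (max_idPr _).
Qed.

Lemma dome_right (R : realType) (a b x : R) :
  a + 1 <= b -> b - 2%:R^-1 <= x <= b -> dome a b x = bend (b - x).
Proof.
move=> ab xa; have ? : 0 <= bend (b - x) by apply: bend_ge0; lra.
have ? : bend (b - x) <= 2%:R^-1 by apply: bend_le; lra.
have ? : 2%:R^-1 <= bend (x - a) by apply: bend_ge; lra.
rewrite /dome (min_idPr (_ : bend (b - x) <= bend (x - a))); last by lra.
by rewrite (min_idPr _) // (max_idPr _).
Qed.

Lemma dome_middle (R : realType) (a b x : R) :
  a + 2%:R^-1 <= x <= b - 2%:R^-1 -> dome a b x = 2%:R^-1.
Proof.
move=> xab; have ? : 2%:R^-1 <= bend (b - x) by apply: bend_ge; lra.
have ? : 2%:R^-1 <= bend (x - a) by apply: bend_ge; lra.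
have /min_idPl minE : 2%:R^-1 <= Num.min (bend (x - a)) (bend (b - x)).
  by rewrite le_min; apply/andP.
by rewrite /dome minE; apply/max_idPr; lra.
Qed.

(** * The push moves the segment to the cup *)

Lemma traditional_link (R : realType) n (M : 'M[tile]_n) :
  mosaic_link (R := R) Traditional M =
  [set x | exists i j, exists2 u, u \in strands (tile_at M i j) &
     diamond_path i.*2 j.*2 u x].
Proof.
apply/seteqP; split=> [x [i [j [u uM xu]]]|x [i [j [u]]]] /=.
  by exists i, j, u; rewrite ?tile_at_ord -?strand_path_traditional.
case: tile_atP => // i' j' -> -> uM xu; exists i', j', u => //.
by rewrite strand_path_traditional.
Qed.

Lemma diamond_pathE (R : realType) a b u (x y z : R) :
  diamond_path a b u (x, y, z) <->
  diamond_path 0 0 u (x - a%:R / 2%:R, y - b%:R / 2%:R, z).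
Proof.
rewrite diamond_path_shift; split=> [[[[x' y'] z'] xu]|xu].
  by rewrite add3E => -[<- <- <-]; rewrite !addrK addr0.
eexists; first exact: xu.
by rewrite /= add3E; congr (_, _, _); rewrite ?subrK ?addr0.
Qed.

Lemma tile_pathE (R : realType) (i j : nat) u (x y z : R) :
  diamond_path i.*2 j.*2 u (x, y, z) <->
  diamond_path 0 0 u (x - i%:R, y - j%:R, z).
Proof.
rewrite diamond_pathE -!muln2 !natrM.
by have e (k : R) : k * 2%:R / 2%:R = k by [field]; rewrite !e.
Qed.

Lemma line_pathP (R : realType) (m j : nat) (x y z : R) :
  diamond_path m.*2.+1 j.*2.+1 (1, 3%:R, false) (x, y, z) <->
  [/\ m%:R + 2%:R^-1 <= x <= m%:R + 1 + 2%:R^-1, y = j%:R + 1 & z = 0].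
Proof.
rewrite diamond_pathE line13P -[m.*2.+1%:R]natr1 -[j.*2.+1%:R]natr1 -!muln2 !natrM.
by split=> -[? ? ?]; split; lra.
Qed.

Lemma strands_diamond T i0 i1 j0 a b u :
  u \in strands (diamond T i0 i1 j0 a b) ->
  (exists m, [/\ a = m.*2.+1, b = j0.*2.+1, (i0 <= m < i1)%N
     & u = (1, 3%:R, false)]) \/
  (exists i j, [/\ a = i.*2, b = j.*2, ~~ in_cup i0 i1 j0 i j
     & u \in strands (T i j)]).
Proof.
case: diamondP => // [m im|i j ij] uD; [left|right].
  by exists m; split=> //; move: uD; rewrite inE => /eqP.
by exists i, j.
Qed.

Lemma clamp_eq0 (R : realType) (h w : R) :
  0 <= h -> h = 0 \/ w <= 0 -> clamp h w = 0.
Proof. by move=> h0 hw; case: (clampP w h0) => -[? ->]; lra. Qed.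

Lemma clamp_self (R : realType) (h : R) : 0 <= h -> clamp h h = h.
Proof. by move=> h0; case: (clampP h h0) => -[? ->]; lra. Qed.

Lemma natr_lt (R : numDomainType) (k l : nat) :
  (k < l)%N -> k%:R + 1 <= l%:R :> R.
Proof. by move=> kl; rewrite natr1 ler_nat. Qed.

Definition cup_push (R : realType) (i0 i1 j0 : nat) : space3 R -> space3 R :=
  push_down (dome (i0%:R + 2%:R^-1) (i1%:R + 2%:R^-1)) (j0%:R + 1).

(** Off the cup [dome] vanishes, and in the cup only the row above matters.
    There the inner tiles have nothing at the bottom and stay at distance 1/2
    from it, while [strand_above] takes care of the tiles above the two ends. *)
Lemma cup_push_fixed (R : realType) n T i0 i1 j0 i j u (p : space3 R) :
  connected_tiling n T -> cup T i0 i1 j0 -> ~~ in_cup i0 i1 j0 i j ->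
  u \in strands (T i j) -> diamond_path i.*2 j.*2 u p ->
  cup_push i0 i1 j0 p = p.
Proof.
move=> [_ V _ _ _] [i01 Ti0 Ti1 mid below] ij uT; case: p => -[x y] z.
rewrite tile_pathE => /(strand_above uT)[x01 y0 yno yright yleft].
have i01R := natr_lt R i01.
set a : R := i0%:R + 2%:R^-1; set b : R := i1%:R + 2%:R^-1.
have aE : a = i0%:R + 2%:R^-1 by []. have bE : b = i1%:R + 2%:R^-1 by [].
rewrite /cup_push -/a -/b /push_down /= clamp_eq0 ?subr0 ?dome_ge0 //.
have := dome_le a b x.
have [i_lt|i_ge] := ltnP i i0.
  by left; apply: dome_out; left; have := natr_lt R i_lt; lra.
have [i_gt|i_le] := ltnP i1 i.
  by left; apply: dome_out; right; have := natr_lt R i_gt; lra.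
have [j_lt|j_ge] := ltnP j j0; first by rewrite below // in uT.
have j_gt : (j0 < j)%N.
  by move: ij; rewrite /in_cup ltn_neqAle j_ge eq_sym i_ge i_le !andbT.
have [j_gt1|j_le] := ltnP j0.+1 j.
  by right; have := natr_lt R j_gt1; rewrite -natr1; lra.
have jE : j = j0.+1 by apply/eqP; rewrite eqn_leq j_le.
have jR : j%:R = j0%:R + 1 :> R by rewrite jE natr1.
have [iE|i_ne0] := eqVneq i i0.
  have iR : i%:R = i0%:R :> R by rewrite iE.
  have [xa|xa] := leP x a; first by left; apply: dome_out; left.
  right; rewrite dome_left; [|lra|lra].
  rewrite (_ : x - a = x - i%:R - 2%:R^-1); last by lra.
  by have := yright; lra.
have [iE|i_ne1] := eqVneq i i1.
  have iR : i%:R = i1%:R :> R by rewrite iE.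
  have [xb|xb] := leP b x; first by left; apply: dome_out; right.
  right; rewrite dome_right; [|lra|lra].
  rewrite (_ : b - x = 2%:R^-1 - (x - i%:R)); last by lra.
  by have := yleft; lra.
have : 2%:R^-1 <= y - j%:R.
  apply: yno; rewrite jE -V mid // !ltn_neqAle i_ge i_le.
  by rewrite eq_sym i_ne0 i_ne1.
by right; lra.
Qed.

(** The cup is the part of the graph of [j0 + 1 - dome] over the union of the
    ranges of the pieces of the segment.  Piece [m] lies over the right half of
    tile [m] and the left half of tile [m + 1]. *)
Lemma cup_pathP (R : realType) T i0 i1 j0 (x y z : R) :
  cup T i0 i1 j0 ->
  (exists i u, [/\ (i0 <= i <= i1)%N, u \in strands (T i j0) &
     diamond_path i.*2 j0.*2 u (x, y, z)]) <->
  [/\ exists2 m, (i0 <= m < i1)%N & m%:R + 2%:R^-1 <= x <= m%:R + 1 + 2%:R^-1,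
    y = j0%:R + 1 - dome (i0%:R + 2%:R^-1) (i1%:R + 2%:R^-1) x & z = 0].
Proof.
move=> [i01 Ti0 Ti1 mid _].
have i01R := natr_lt R i01.
set a : R := i0%:R + 2%:R^-1; set b : R := i1%:R + 2%:R^-1.
have aE : a = i0%:R + 2%:R^-1 by []. have bE : b = i1%:R + 2%:R^-1 by [].
have left_end : i0%:R + 2%:R^-1 <= x <= i0%:R + 1 ->
    dome a b x = bend (x - i0%:R - 2%:R^-1).
  by move=> ?; rewrite dome_left; [congr bend; lra|lra|lra].
have right_end : i1%:R <= x <= i1%:R + 2%:R^-1 ->
    dome a b x = bend (2%:R^-1 - (x - i1%:R)).
  by move=> ?; rewrite dome_right; [congr bend; lra|lra|lra].
have middle i : (i0 < i < i1)%N -> i%:R <= x <= i%:R + 1 ->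
    dome a b x = 2%:R^-1.
  case/andP=> /(natr_lt R) ? /(natr_lt R) ? ?; rewrite dome_middle //; lra.
split.
  case=> i [u [i_in uT]]; rewrite tile_pathE.
  have [iE|i_ne0] := eqVneq i i0.
    move: uT; rewrite iE Ti0 inE => /eqP-> /arc12P[xi yE zE].
    split=> //; last by rewrite left_end; lra.
    by exists i0; [rewrite leqnn|lra].
  have [iE|i_ne1] := eqVneq i i1.
    move: uT; rewrite iE Ti1 inE => /eqP-> /arc23P[xi yE zE].
    split=> //; last by rewrite right_end; lra.
    exists i1.-1; first by clear - i01; lia.
    have : i1.-1%:R + 1 = i1%:R :> R by rewrite natr1 prednK //; clear - i01; lia.
    by lra.
  have i_mid : (i0 < i < i1)%N by clear - i_in i_ne0 i_ne1; lia.
  move: uT; rewrite mid // inE => /eqP-> /line13P[xi yE zE].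
  split=> //; last by rewrite (middle _ i_mid); lra.
  have [x2|x2] := leP (i%:R + 2%:R^-1) x; first by exists i; [clear - i_mid; lia|lra].
  exists i.-1; first by clear - i_mid; lia.
  have : i.-1%:R + 1 = i%:R :> R by rewrite natr1 prednK //; clear - i_mid; lia.
  by lra.
case=> -[m /andP[i0m mi1] xm] yE zE.
have mi1R := natr_lt R mi1.
have i0mR : i0%:R <= m%:R :> R by rewrite ler_nat.
have [xm1|xm1] := leP x (m%:R + 1).
  have [mE|m_ne0] := eqVneq m i0.
    rewrite mE in xm xm1; exists i0, (1, 2%:R, false); rewrite Ti0 inE.
    split; [by rewrite leqnn ltnW|by []|].
    by rewrite tile_pathE arc12P; split; rewrite ?yE ?left_end; lra.
  have m_mid : (i0 < m < i1)%N by clear - i0m mi1 m_ne0; lia.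
  exists m, (1, 3%:R, false); rewrite mid // inE; split; [clear - m_mid; lia|by []|].
  by rewrite tile_pathE line13P; split; rewrite ?yE ?(middle _ m_mid); lra.
have mR : m.+1%:R = m%:R + 1 :> R by rewrite -natr1.
have [mE|m_ne1] := eqVneq m.+1 i1.
  rewrite mE in mR; exists i1, (2%:R, 3%:R, false); rewrite Ti1 inE.
  split; [by rewrite leqnn ltnW|by []|].
  by rewrite tile_pathE arc23P; split; rewrite ?yE ?right_end; lra.
have m_mid : (i0 < m.+1 < i1)%N by clear - i0m mi1 m_ne1; lia.
exists m.+1, (1, 3%:R, false); rewrite mid // inE; split; [clear - m_mid; lia|by []|].
by rewrite tile_pathE line13P; split; rewrite ?yE ?(middle _ m_mid); lra.
Qed.

Lemma cup_push_link (R : realType) n (M : 'M[tile]_n) i0 i1 j0 :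
  connected_tiling n (tile_at M) -> cup (tile_at M) i0 i1 j0 ->
  cup_push i0 i1 j0 @` diamond_link (R := R) (diamond (tile_at M) i0 i1 j0) =
  mosaic_link Traditional M.
Proof.
move=> conn cupM; rewrite traditional_link.
have pushE (x : R) : cup_push i0 i1 j0 (x, j0%:R + 1, 0) =
    (x, j0%:R + 1 - dome (i0%:R + 2%:R^-1) (i1%:R + 2%:R^-1) x, 0).
  by rewrite /cup_push /push_down /= subrr add0r clamp_self ?dome_ge0.
apply/seteqP; split=> [_ [p [a [b [u uD pu]]] <-]|p [i [j [u uM pu]]]].
  case: (strands_diamond uD) => [[m [aE bE im uE]]|[i [j [aE bE ij uT]]]].
    case: p pu => -[x y] z; rewrite aE bE uE => /line_pathP[xm -> ->].
    rewrite pushE.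
    have [|i [v [_ vT xv]]] := (cup_pathP x
      (j0%:R + 1 - dome (i0%:R + 2%:R^-1) (i1%:R + 2%:R^-1) x) 0 cupM).2.
      by split=> //; exists m.
    by exists i, j0, v.
  rewrite aE bE in pu; rewrite (cup_push_fixed conn cupM ij uT pu).
  by exists i, j, u.
have [/andP[/eqP jE i_in]|ij] := boolP (in_cup i0 i1 j0 i j).
  rewrite jE in uM pu; case: p pu => -[x y] z pu.
  have /(cup_pathP _ _ _ cupM)[[m im xm] yE zE] : exists i u,
      [/\ (i0 <= i <= i1)%N, u \in strands (tile_at M i j0) &
        diamond_path i.*2 j0.*2 u (x, y, z)] by exists i, u.
  exists (x, j0%:R + 1, 0); last by rewrite pushE yE zE.
  exists m.*2.+1, j0.*2.+1, (1, 3%:R, false).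
    by rewrite diamond_line.
  by apply/line_pathP.
exists p; last exact: (cup_push_fixed conn cupM ij uM pu).
by exists i.*2, j.*2, u; rewrite ?diamond_tile.
Qed.

(** * Conclusion *)

Lemma tame_link_nonempty (R : realType) mu (K : set (space3 R)) :
  (0 < mu)%N -> tame_link_with mu K -> K !=set0.
Proof.
move=> mu0 [s [simple _ [H [_ <-]]]]; have [s2 _ _] := simple _ mu0.
exists (H 1 (edge_ends (s 0%N) 0).1), (edge_ends (s 0%N) 0).1 => //.
exists 0%N => //; exists 0%N; first by apply: leq_trans s2.
by exists 0; [rewrite lexx ler01|rewrite subr0 scale1r scale0r addr0].
Qed.

Lemma corner_mosaic_shorter (R : realType) n (M : 'M[tile]_n)
    (K : set (space3 R)) :
  constructs Traditional M K -> K !=set0 ->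
  exists m (M' : 'M[tile]_m),
    constructs Corner M' K /\ (nonblank_tiles M' < nonblank_tiles M)%N.
Proof.
move=> [Mm MK] [y Ky].
have conn := mosaic_connected Mm.
have [i [j Tij]] : exists i j, tile_at M i j <> Blank.
  have [H [_ HK]] := MK; move: Ky; rewrite -HK => -[x [i [j [u uM _]]] _].
  by exists i, j; rewrite tile_at_ord => M0; rewrite M0 in uM.
have [i0 [i1 [j0 cupM]]] := bottom_path conn Tij.
pose D := diamond (tile_at M) i0 i1 j0.
have supp := diamond_support conn cupM.
exists n.*2, (corner_mosaic n D); split; last exact: corner_mosaic_count.
split.
  by apply: corner_mosaic_is_mosaic => //; apply: diamond_mosaic conn cupM.
apply: ambient_isotopic_trans (unturn_isotopic n%:R _) _.
rewrite unturn_corner_link //.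
apply: ambient_isotopic_trans MK.
rewrite -(cup_push_link _ conn cupM).
by apply: push_down_isotopic; [exact: dome_continuous|exact: dome_ge0].
Qed.

Theorem theorem4p1 (R : realType) (K : set (space3 R))
    (hK : tame_knot K \/ (tame_link K /\ ~ split_link K))
    (t : nat) (ht : tile_number Traditional K t) :
  exists2 tc : nat, tile_number Corner K tc & (tc < t)%N.
Proof.
have K0 : K !=set0.
  case: hK => [|[[mu mu0] + _]]; last exact: tame_link_nonempty.
  exact: tame_link_nonempty.
case: ht => -[n [M [MK Mt]]] _.
have [m [M' [M'K M't]]] := corner_mosaic_shorter MK K0.
pose P c := `[< exists m (M : 'M[tile]_m),
  constructs Corner M K /\ nonblank_tiles M = c >].
have exP : exists c, P c.
  by exists (nonblank_tiles M'); apply/asboolP; exists m, M'.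
case: (ex_minnP exP) => c /asboolP cP c_min; exists c.
  split=> // m1 M1 M1K; apply: c_min; apply/asboolP; by exists m1, M1.
rewrite -Mt; apply: leq_ltn_trans M't; apply: c_min; apply/asboolP.
by exists m, M'.
Qed.
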